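(* Let $A\in\mathbb{C}^{n\times n}$ be Hermitian with eigenvalues $\lambda_1\le\dots\le\lambda_n$, let $1\le \ell<n$, and let $[\alpha,\beta]$, $\alpha<\beta$, be an interval with $\lambda_1,\dots,\lambda_\ell<\alpha$ and $\lambda_{\ell+1},\dots,\lambda_n\in[\alpha,\beta]$. Let $V\in\mathbb{C}^{n\times\ell}$ have orthonormal columns, let $m=(m_1,\dots,m_\ell)$ be positive integers with $m_1\le m_2\le\dots\le m_\ell$, and let $p_m(A)V$ be the array filtered with the optimized degrees $m$ (with the representation of $p_m(A)V$ and the numbers $|\rho_a|$ given in the context). Assume that $$1<|\rho_\ell|^{m_\ell}<1+\sqrt2 .$$ Then $$\kappa_2\big(p_m(A)V\big)\le \eta\,|\rho_1|^{m_\ell},\qquad \eta:=\frac{|\rho_\ell|^{m_\ell}+1}{|\rho_\ell|^{m_\ell}\,(|\rho_\ell|^{m_\ell}-1)}>1 .$$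
   Context: For a rectangular matrix $M$, $\kappa_2(M)=\|M\|_2\|M^+\|_2=\sigma_{\max}(M)/\sigma_{\min}(M)$, where $M^+$ is the pseudo-inverse and $\sigma_{\max},\sigma_{\min}$ are the largest and smallest non-zero singular values. Put $c=\frac{\alpha+\beta}{2}$, $e=\frac{\beta-\alpha}{2}$. For $\lambda_a\notin[\alpha,\beta]$ define $$|\rho_a|=\max_{\pm}\left|\frac{\lambda_a-c}{e}\pm\sqrt{\Big(\frac{\lambda_a-c}{e}\Big)^2-1}\right|>1 .$$ So $|\rho_1|\ge|\rho_2|\ge\dots\ge|\rho_\ell|>1$. A filter of degree $d$ is $p_d(\lambda)=C_d\big(\frac{\lambda-c}{e}\big)/C_d\big(\frac{\lambda_1-c}{e}\big)$, with $C_d$ the Chebyshev polynomial of the first kind. With optimized degrees, column $v_a$ of $V$ is filtered with degree $m_a$. Let $A=X\Lambda X^H$ be a spectral decomposition with $X=(X_\ell\ X_3)$ unitary, where $X_\ell\in\mathbb{C}^{n\times\ell}$ contains eigenvectors for $\lambda_1,\dots,\lambda_\ell$ and $X_3$ contains those for $\lambda_{\ell+1},\dots,\lambda_n$. Put $S_\ell=X_\ell^HV\in\mathbb{C}^{\ell\times\ell}$ and $S_3=X_3^HV\in\mathbb{C}^{(n-\ell)\times\ell}$. It is a standing assumption that $S_\ell$ is invertible. Standing convention of the paper: in the optimized-degree case the filtered array is represented as $$p_m(A)V = X_\ell\Gamma_\ell^mS_\ell+X_3\Gamma_3^mS_3,$$ with $$\Gamma_\ell^m=\mathrm{diag}\Big(1,\frac{|\rho_2|^{m_2}}{|\rho_1|^{m_2}},\dots,\frac{|\rho_\ell|^{m_\ell}}{|\rho_1|^{m_\ell}}\Big),\qquad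 \Gamma_3^m=|\rho_1|^{-m_\ell}I_{n-\ell}.$$ The claim is about the matrix $p_m(A)V$ given by this expression. *)

(* Defs.v *)
From HB Require Import structures.
From mathcomp Require Import all_boot all_order all_algebra.
From mathcomp Require Import sesquilinear spectral.
From mathcomp Require Import reals complex.

Set Implicit Arguments.
Unset Strict Implicit.
Unset Printing Implicit Defensive.

Import Order.TTheory GRing.Theory Num.Theory.
Local Open Scope ring_scope.
Local Open Scope complex_scope.
Local Open Scope sesquilinear_scope.

Section SingularValues.
Variables (R : realType) (n p : nat).
Implicit Type M : 'M[R[i]]_(n, p).

(* The square roots of the eigenvalues of M^H M, with multiplicity; when
   n < p this list has p - n additional zeros. *)
Definition singular_value M (j : 'I_p) : R :=
  Num.sqrt (complex.Re (spectral_diag (M^t* *m M) 0 j)).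

Definition sigma_max M : R := \big[Num.max/0]_(j < p) singular_value M j.

(* The minimum starts from sigma_max M, which for M != 0 is itself one of the
   nonzero singular values. *)
Definition sigma_min M : R :=
  \big[Num.min/sigma_max M]_(j < p | singular_value M j != 0)
    singular_value M j.

Definition kappa2 M : R := sigma_max M / sigma_min M.

Lemma singular_valueP M (s : R) :
  (exists j, singular_value M j = s) <->
  0 <= s /\ eigenvalue (M^t* *m M) (s ^+ 2)%:C.
Proof.
set B := M^t* *m M; set d := spectral_diag B; set P := spectralmx B.
have Bherm : B \is hermsymmx.
  apply/is_hermitianmxP; rewrite expr0 scale1r /B trmx_mul map_mxM /=.
  by rewrite trmxCK.
have PU : P \is unitarymx by exact: spectral_unitarymx.
have PV : P *m P^t* = 1%:M by apply/unitarymxP.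
have BE : B = P^t* *m diag_mx d *m P.
  rewrite -(invmx_unitary PU); apply/orthomx_spectralP.
  exact: hermitian_normalmx.
have dE : diag_mx d = (M *m P^t*)^t* *m (M *m P^t*).
  rewrite trmx_mul map_mxM /= trmxCK mulmxA -(mulmxA P) -/B BE.
  by rewrite !mulmxA PV mul1mx -mulmxA PV mulmx1.
have d_ge0 j : 0 <= d 0 j.
  have := congr1 (fun N : 'M_p => N j j) dE; rewrite !mxE eqxx mulr1n => ->.
  by apply: sumr_ge0 => i _; rewrite [((M *m P^t*)^t*) _ _]mxE [((M *m P^t*)^T) _ _]mxE mulrC mul_conjC_ge0.
have dRe j : d 0 j = (complex.Re (d 0 j))%:C.
  by move: (d_ge0 j); case: (d 0 j) => a b; rewrite lecE /= => /andP[/eqP -> _].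
have eigE a : eigenvalue B a = [exists j, d 0 j == a].
  apply/eigenvalueP/existsP => [[v vB v0]|[j /eqP dj]].
    have w0 : v *m P^t* != 0.
      apply: contraNneq v0 => vP0; rewrite -(mulmx1 v).
      have -> : 1%:M = P^t* *m P by rewrite -invmx_unitary// mulVmx// unitarymx_unit.
      by rewrite mulmxA vP0 mul0mx.
    have /rV0Pn[j wj] := w0; exists j.
    have : (v *m P^t*) *m diag_mx d = a *: (v *m P^t*).
      by rewrite scalemxAl -vB BE !mulmxA -(mulmxA _ P) PV mulmx1.
    move=> /rowP/(_ j); rewrite mul_mx_diag !mxE mulrC => /mulIf /eqP; apply.
    by move: wj; rewrite mxE.
  exists (row j P).
    rewrite BE !mulmxA -row_mul PV.
    by rewrite row1 -rowE row_diag_mx -scalemxAl -rowE dj.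
  apply/eqP => Pj; have : row j (P *m P^t*) = 0 by rewrite row_mul Pj mul0mx.
  by rewrite PV row1 => /rowP/(_ j); rewrite !mxE !eqxx => /eqP; rewrite oner_eq0.
rewrite eigE; split=> [[j <-]|[s0 /existsP[j /eqP dj]]].
  split; first exact: sqrtr_ge0.
  apply/existsP; exists j; rewrite sqr_sqrtr -/B -/d -?dRe//.
  by move: (d_ge0 j); rewrite lecE => /andP[].
by exists j; rewrite /singular_value -/B -/d dj /= sqrtr_sqr ger0_norm.
Qed.

End SingularValues.

(* Only meaningful for lam outside [alpha, beta], where the radicand is
   positive. *)
Definition rho_abs (R : realType) (alpha beta lam : R) : R :=
  let c := (alpha + beta) / 2 in
  let e := (beta - alpha) / 2 in
  let t := (lam - c) / e in
  Num.max `|t + Num.sqrt (t ^+ 2 - 1)| `|t - Num.sqrt (t ^+ 2 - 1)|.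

Section FilteredArray.
(* The number of filtered columns is l.+1, and k = n - l.+1. *)
Variables (R : realType) (l k : nat).
Variables (rho : 'I_l.+1 -> R) (m : 'I_l.+1 -> nat).

Definition Gamma_l : 'M[R[i]]_l.+1 :=
  diag_mx (\row_a if a == ord0 then 1
                  else (rho a ^+ m a / rho ord0 ^+ m a)%:C).

Definition Gamma_3 : 'M[R[i]]_k := ((rho ord0 ^- m ord_max)%:C)%:M.

(* X_l = lsubmx X and X_3 = rsubmx X are the two column blocks of X. *)
Definition filtered_array (X : 'M[R[i]]_(l.+1 + k))
    (V : 'M[R[i]]_(l.+1 + k, l.+1)) : 'M[R[i]]_(l.+1 + k, l.+1) :=
  let S_l := (lsubmx X)^t* *m V in
  let S_3 := (rsubmx X)^t* *m V in
  lsubmx X *m Gamma_l *m S_l + rsubmx X *m Gamma_3 *m S_3.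

End FilteredArray.

Definition eta_factor (R : realType) (x : R) : R := (x + 1) / (x * (x - 1)).

(* Main.v *)
Require Import Defs.
From HB Require Import structures.
From mathcomp Require Import all_boot all_order all_algebra.
From mathcomp Require Import sesquilinear spectral.
From mathcomp Require Import reals complex.
From mathcomp Require Import ring lra.

Set Implicit Arguments.
Unset Strict Implicit.
Unset Printing Implicit Defensive.

Import Order.TTheory GRing.Theory Num.Theory.
Local Open Scope ring_scope.
Local Open Scope complex_scope.
Local Open Scope sesquilinear_scope.

(** The filtered array is a product X D Q, where X is unitary, D is the real
    diagonal matrix with blocks Gamma_l and Gamma_3, and Q = X^H V has
    orthonormal columns.  Hence every singular value of the array lies between
    the smallest and the largest diagonal entry of D
    ([singular_value_isometry_diag]).  All of these entries lie in
    [|rho_1|^-m_l, 1]: the numbers |rho_a| exceed 1 and are largest for the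
    leftmost eigenvalue ([rho_abs_gt1], [rho_abs_anti]), and m_a <= m_l, so
      |rho_1|^-m_l <= |rho_1|^-m_a <= (|rho_a| / |rho_1|)^m_a <= 1.
    The condition number is therefore at most |rho_1|^m_l ([kappa2_le]).
    The factor eta only weakens this bound: with x = |rho_l|^m_l > 1, eta > 1
    says that x^2 - 2 x - 1 < 0, which holds for x < 1 + sqrt 2
    ([eta_factor_gt1]). *)

(** * Singular values and the condition number *)

Lemma row_normE (R : realType) (p : nat) (v : 'rV[R[i]]_p) :
  (v *m v^t*) 0 0 = \sum_i v 0 i * (v 0 i)^*.
Proof. by rewrite mxE; apply: eq_bigr => i _; rewrite !mxE. Qed.

Lemma row_norm_gt0 (R : realType) (p : nat) (v : 'rV[R[i]]_p) :
  v != 0 -> 0 < (v *m v^t*) 0 0.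
Proof.
case/rV0Pn => j vj; rewrite row_normE (bigD1 j) //=.
apply: ltr_pwDl; first by rewrite mul_conjC_gt0.
by apply: sumr_ge0 => i _; exact: mul_conjC_ge0.
Qed.

(** If s is a singular value of M = U D Q, then M^H M has an eigenvector v for
    s^2, and with y = v Q^H, a vector as long as v, this reads
    s^2 sum_i |y_i|^2 = sum_i d_i^2 |y_i|^2, so s^2 is a weighted mean of the
    squares d_i^2. *)
Lemma singular_value_isometry_diag (R : realType) (q n p : nat)
    (U : 'M[R[i]]_(q, n)) (d : 'I_n -> R) (Q : 'M[R[i]]_(n, p)) (lo hi : R)
    (j : 'I_p) :
  U^t* *m U = 1%:M -> Q^t* *m Q = 1%:M ->
  0 <= lo -> 0 <= hi -> (forall i, lo <= d i <= hi) ->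
  lo <= singular_value (U *m diag_mx (\row_i (d i)%:C) *m Q) j <= hi.
Proof.
move=> UU QQ lo0 hi0 dP; set M := U *m _ *m Q; set s := singular_value M j.
have [s0 /eigenvalueP[v vB v0]] : 0 <= s /\ eigenvalue (M^t* *m M) (s ^+ 2)%:C.
  by apply/singular_valueP; exists j.
pose y := v *m Q^t*.
have yy : y *m y^t* = v *m v^t*.
  by rewrite /y trmx_mul map_mxM /= trmxCK !mulmxA -(mulmxA v) QQ mulmx1.
have y_gt0 : 0 < \sum_i y 0 i * (y 0 i)^*.
  by rewrite -row_normE yy row_norm_gt0.
have sE : (s ^+ 2)%:C * (\sum_i y 0 i * (y 0 i)^*) =
    \sum_i (d i ^+ 2)%:C * (y 0 i * (y 0 i)^*).
  rewrite -row_normE yy.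
  have <- : (v *m (M^t* *m M) *m v^t*) 0 0 = (s ^+ 2)%:C * (v *m v^t*) 0 0.
    by rewrite vB -scalemxAl mxE.
  pose D := diag_mx (\row_i (d i)%:C : 'rV[R[i]]_n).
  have -> : v *m (M^t* *m M) *m v^t* = (y *m D^t*) *m (D *m y^t*).
    rewrite /M /y !trmx_mul !map_mxM /= trmxCK -/D !mulmxA.
    by rewrite -(mulmxA _ _ U) UU mulmx1.
  clearbody y.
  have DC : D^t* = D.
    apply/matrixP => a b; rewrite !mxE rmorphMn /= eq_sym.
    case: eqP => [->|_]; last by rewrite !mulr0n.
    exact: conjc_real.
  rewrite DC /D mul_mx_diag mul_diag_mx mxE; apply: eq_bigr => i _.
  by rewrite !mxE rmorphXn /=; ring.
have yy_ge0 i : 0 <= y 0 i * (y 0 i)^* by exact: mul_conjC_ge0.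
apply/andP; split.
- rewrite -(ler_pXn2r (n := 2)) ?nnegrE // -lecR -(ler_pM2r y_gt0) sE mulr_sumr.
  apply: ler_sum => i _; apply: ler_wpM2r => //.
  have /andP[lod _] := dP i.
  by rewrite lecR ler_pXn2r ?nnegrE // (le_trans lo0).
- rewrite -(ler_pXn2r (n := 2)) ?nnegrE // -lecR -(ler_pM2r y_gt0) sE mulr_sumr.
  apply: ler_sum => i _; apply: ler_wpM2r => //.
  have /andP[lod dhi] := dP i.
  by rewrite lecR ler_pXn2r ?nnegrE // (le_trans lo0).
Qed.

Lemma kappa2_le (R : realType) (n p : nat) (M : 'M[R[i]]_(n, p.+1)) (lo hi : R) :
  0 < lo -> (forall j, lo <= singular_value M j <= hi) ->
  kappa2 M <= hi / lo.
Proof.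
move=> lo0 sP.
have /andP[lo_s s_hi] := sP ord0.
have max_hi : sigma_max M <= hi.
  apply: (big_ind (fun z => z <= hi)) => [|a b ha hb|j _].
  - exact: le_trans (ltW lo0) (le_trans lo_s s_hi).
  - by rewrite ge_max ha hb.
  - by have /andP[] := sP j.
have lo_max : lo <= sigma_max M.
  by rewrite /sigma_max big_ord_recl le_max lo_s.
have lo_min : lo <= sigma_min M.
  apply: (big_ind (fun z => lo <= z)) => [//|a b ha hb|j _].
  - by rewrite le_min ha hb.
  - by have /andP[] := sP j.
rewrite /kappa2; apply: ler_pM => //.
- exact: le_trans (ltW lo0) lo_max.
- by rewrite invr_ge0 (le_trans (ltW lo0)).
- by rewrite lef_pV2 ?posrE // (lt_le_trans lo0).
Qed.

(** * The filter values *)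

Lemma lt_affine_image (R : realType) (alpha beta lam : R) :
  alpha < beta -> lam < alpha ->
  (lam - (alpha + beta) / 2) / ((beta - alpha) / 2) < -1.
Proof.
move=> ab la; rewrite ltr_pdivrMr; last by rewrite divr_gt0 ?subr_gt0.
lra.
Qed.

(** Left of the interval the argument t is below -1, so the maximum is attained
    by t - sqrt (t^2 - 1), in which both terms are negative. *)
Lemma rho_absE (R : realType) (alpha beta lam : R) :
  alpha < beta -> lam < alpha ->
  let t := (lam - (alpha + beta) / 2) / ((beta - alpha) / 2) in
  rho_abs alpha beta lam = Num.sqrt (t ^+ 2 - 1) - t.
Proof.
move=> ab la t; have t1 : t < -1 by exact: lt_affine_image.
rewrite /rho_abs /= -/t.
have s0 := sqrtr_ge0 (t ^+ 2 - 1); set s := Num.sqrt _ in s0 *.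
have -> : `|t - s| = s - t by rewrite ler0_norm; lra.
by apply/max_idPr; rewrite ler_norml; apply/andP; split; lra.
Qed.

Lemma rho_abs_gt1 (R : realType) (alpha beta lam : R) :
  alpha < beta -> lam < alpha -> 1 < rho_abs alpha beta lam.
Proof.
move=> ab la; rewrite rho_absE //.
have := lt_affine_image ab la; set t := _ / _ => t1.
have := sqrtr_ge0 (t ^+ 2 - 1); lra.
Qed.

Lemma rho_abs_anti (R : realType) (alpha beta lam mu : R) :
  alpha < beta -> mu < alpha -> lam <= mu ->
  rho_abs alpha beta mu <= rho_abs alpha beta lam.
Proof.
move=> ab ma lm; have la := le_lt_trans lm ma.
rewrite !rho_absE //.
have := lt_affine_image ab ma; set t := _ / _ => t1.
have : (lam - (alpha + beta) / 2) / ((beta - alpha) / 2) <= t.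
  by rewrite ler_pM2r ?invr_gt0 ?divr_gt0 ?subr_gt0 // lerD2r.
set u := _ / _ => ut.
apply: lerD; last by rewrite lerN2.
by rewrite ler_sqrt; nra.
Qed.

Lemma eta_factor_gt1 (R : realType) (x : R) :
  1 < x -> x < 1 + Num.sqrt 2 -> 1 < eta_factor x.
Proof.
move=> x1 xs; rewrite /eta_factor ltr_pdivlMr; last by nra.
have s2 : Num.sqrt 2 ^+ 2 = 2 :> R by rewrite sqr_sqrtr.
nra.
Qed.

Lemma filter_quotient_bounds (R : realFieldType) (r r1 : R) (m M : nat) :
  1 <= r -> r <= r1 -> (m <= M)%N ->
  r1 ^- M <= r ^+ m / r1 ^+ m <= 1.
Proof.
move=> r_ge1 rr1 mM; have r1_ge1 := le_trans r_ge1 rr1.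
have r1_gt0 : 0 < r1 by exact: lt_le_trans ltr01 r1_ge1.
have r_ge0 : 0 <= r by exact: le_trans ler01 r_ge1.
apply/andP; split.
  apply: (@le_trans _ _ (r1 ^- m)).
    by rewrite lef_pV2 ?posrE ?exprn_gt0 // ler_weXn2l.
  by rewrite ler_peMl ?exprn_ege1 // invr_ge0 exprn_ge0 // ltW.
by rewrite ler_pdivrMr ?exprn_gt0 // mul1r lerXn2r // ?nnegrE // ltW.
Qed.

(** * The filtered array *)

Definition filter_diag (R : realType) (l k : nat) (rho : 'I_l.+1 -> R)
    (m : 'I_l.+1 -> nat) (i : 'I_(l.+1 + k)) : R :=
  match split i with
  | inl a => if a == ord0 then 1 else rho a ^+ m a / rho ord0 ^+ m a
  | inr _ => rho ord0 ^- m ord_max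
  end.

Lemma filtered_arrayE (R : realType) (l k : nat) (rho : 'I_l.+1 -> R)
    (m : 'I_l.+1 -> nat) (X : 'M[R[i]]_(l.+1 + k))
    (V : 'M[R[i]]_(l.+1 + k, l.+1)) :
  filtered_array rho m X V =
  X *m diag_mx (\row_i (filter_diag rho m i)%:C) *m (X^t* *m V).
Proof.
have -> : \row_i (filter_diag rho m i)%:C =
    row_mx (\row_a if a == ord0 then 1
                   else (rho a ^+ m a / rho ord0 ^+ m a)%:C)
           (const_mx ((rho ord0 ^- m ord_max)%:C)) :> 'rV[R[i]]_(l.+1 + k).
  apply/rowP => i; rewrite !mxE /filter_diag.
  by case: (split i) => a; rewrite !mxE //; case: ifP.
rewrite diag_mx_row -[in RHS](hsubmxK X) tr_row_mx map_col_mx mul_row_block.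
by rewrite !mulmx0 addr0 add0r diag_const_mx mul_col_mx mul_row_col.
Qed.


(* The informal l is l.+1 and the informal n is l.+1 + k.+1, which encodes
   1 <= l < n; indices are shifted to start at 0. *)
Theorem mainTheorem2 (R : realType) (l k : nat)
    (A : 'M[R[i]]_(l.+1 + k.+1)) (X : 'M[R[i]]_(l.+1 + k.+1))
    (lam : 'I_(l.+1 + k.+1) -> R) (alpha beta : R)
    (V : 'M[R[i]]_(l.+1 + k.+1, l.+1)) (m : 'I_l.+1 -> nat)
    (A_herm : A \is hermsymmx)
    (X_unitary : X \is unitarymx)
    (A_spectral : A = X *m diag_mx (\row_i (lam i)%:C) *m X^t*)
    (lam_sorted : forall i j : 'I_(l.+1 + k.+1), (i <= j)%N -> lam i <= lam j)
    (lt_alpha_beta : alpha < beta)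
    (lam_wanted : forall a : 'I_l.+1, lam (lshift k.+1 a) < alpha)
    (lam_unwanted : forall b : 'I_k.+1, alpha <= lam (rshift l.+1 b) <= beta)
    (V_orthonormal : V^t* *m V = 1%:M)
    (S_l_unit : (lsubmx X)^t* *m V \in unitmx)
    (m_gt0 : forall a, (0 < m a)%N)
    (m_sorted : forall a b : 'I_l.+1, (a <= b)%N -> (m a <= m b)%N) :
  let rho := fun a : 'I_l.+1 => rho_abs alpha beta (lam (lshift k.+1 a)) in
  let x := rho ord_max ^+ m ord_max in
  1 < x -> x < 1 + Num.sqrt 2 ->
  kappa2 (filtered_array rho m X V) <= eta_factor x * rho ord0 ^+ m ord_max
  /\ 1 < eta_factor x.
Proof.
move=> rho x x1 xs.
have eta1 := eta_factor_gt1 x1 xs; split; last exact: eta1.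
have rho1 a : 1 < rho a by exact: rho_abs_gt1.
have rho_le a : rho a <= rho ord0 by apply: rho_abs_anti => //; apply: lam_sorted.
set r := rho ord0 ^+ m ord_max.
have r1 : 1 <= r by apply: exprn_ege1; exact: ltW.
have r0 : 0 < r by exact: lt_le_trans ltr01 r1.
have X_isometry : X^t* *m X = 1%:M.
  by rewrite -(invmx_unitary X_unitary) mulVmx // unitarymx_unit.
have Q_isometry : (X^t* *m V)^t* *m (X^t* *m V) = 1%:M.
  rewrite trmx_mul map_mxM /= trmxCK mulmxA -(mulmxA _ X).
  by move/unitarymxP: X_unitary => ->; rewrite mulmx1.
have d_bounds (i : 'I_(l.+1 + k.+1)) : r^-1 <= filter_diag rho m i <= 1.
  rewrite /filter_diag; case: (split i) => [a|_]; last by rewrite lexx invf_le1.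
  case: eqP => _; first by rewrite lexx andbT invf_le1.
  by apply: filter_quotient_bounds; rewrite ?m_sorted ?leq_ord // ltW.
apply: (@le_trans _ _ r); last by rewrite ler_peMl // ltW.
have -> : r = 1 / r^-1 by rewrite invrK mul1r.
rewrite filtered_arrayE; apply: kappa2_le => [|j]; first by rewrite invr_gt0.
by apply: singular_value_isometry_diag; rewrite ?invr_ge0 // ltW.
Qed.
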